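(* Let $\mathbb{F}$ be a field, let $(\mathcal{G},[\cdot,\cdot])$ be a Lie algebra over $\mathbb{F}$, and let $T:\mathcal{G}\to\mathcal{G}$ be a classical R-matrix on $\mathcal{G}$ satisfying $$T([u,T(v)])=[u,T^2(v)]\qquad\text{for all } u,v\in\mathcal{G}.$$ Then the algebraic operation $$u\circ v=T([u,v])-[T(u),v]\qquad (u,v\in\mathcal{G})$$ defines a Novikov algebra over the Lie algebra $\mathcal{G}$.
   Context: All vector spaces and algebras are over a field $\mathbb{F}$. A linear transformation $T$ on a Lie algebra $\mathcal{G}$ is called a classical R-matrix if $[T(u),T(v)]=T([T(u),v])+T([u,T(v)])$ for all $u,v\in\mathcal{G}$. A Novikov algebra is a vector space $\mathcal{A}$ with a bilinear operation $\circ$ such that, for all $u,v,w\in\mathcal{A}$, (i) $(u\circ v)\circ w-u\circ(v\circ w)=(v\circ u)\circ w-v\circ(u\circ w)$, and (ii) $(u\circ v)\circ w=(u\circ w)\circ v$. A Gel'fand-Dorfman bialgebra is a vector space $\mathcal{A}$ with two operations $[\cdot,\cdot]$ and $\circ$ such that $(\mathcal{A},[\cdot,\cdot])$ is a Lie algebra, $(\mathcal{A},\circ)$ is a Novikov algebra, and $$[w,u]\circ v-[w,v]\circ u+[w\circ u,v]-[w\circ v,u]-w\circ[u,v]=0\qquad\text{for all } u,v,w\in\mathcal{A}.$$ In this case $(\mathcal{A},\circ)$ is called a Novikov algebra over the Lie algebra $(\mathcal{A},[\cdot,\cdot])$. *)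

(* Defs.v *)
From HB Require Import structures.
From mathcomp Require Import all_boot all_order all_algebra.

Set Implicit Arguments.
Unset Strict Implicit.
Unset Printing Implicit Defensive.

Import GRing.Theory.
Local Open Scope ring_scope.

Section Structures.
Variables (F : fieldType) (A : lmodType F).
Implicit Types (br circ : A -> A -> A).

Definition bilinear_op (op : A -> A -> A) : Prop := bilinear_for *:%R *:%R op.

(* [u, u] = 0 rather than antisymmetry, so that characteristic 2 is covered. *)
Definition is_lie_algebra br : Prop :=
  [/\ bilinear_op br,
      forall u, br u u = 0
    & forall u v w, br u (br v w) + br v (br w u) + br w (br u v) = 0].

Definition is_classical_Rmatrix br (T : {linear A -> A}) : Prop :=
  forall u v, br (T u) (T v) = T (br (T u) v) + T (br u (T v)).

Definition is_novikov_algebra circ : Prop :=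
  [/\ bilinear_op circ,
      forall u v w, circ (circ u v) w - circ u (circ v w)
                    = circ (circ v u) w - circ v (circ u w)
    & forall u v w, circ (circ u v) w = circ (circ u w) v].

Definition is_gelfand_dorfman_bialgebra br circ : Prop :=
  [/\ is_lie_algebra br,
      is_novikov_algebra circ
    & forall u v w,
        circ (br w u) v - circ (br w v) u + br (circ w u) v
        - br (circ w v) u - circ w (br u v) = 0].

Definition is_novikov_algebra_over br circ : Prop :=
  is_gelfand_dorfman_bialgebra br circ.

End Structures.

(* Main.v *)
Require Import Defs.
From HB Require Import structures.
From mathcomp Require Import all_boot all_order all_algebra.

Set Implicit Arguments.
Unset Strict Implicit.
Unset Printing Implicit Defensive.

Import GRing.Theory.
Local Open Scope ring_scope.

(** In the formulas below [x, y] is the Lie bracket of x and y, and u o v is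
    the new product T [u, v] - [T u, v].

    By antisymmetry the hypothesis T [u, T v] = [u, T^2 v] has the mirror image
    T [T u, v] = [T^2 u, v], and the R-matrix identity then becomes
    [T u, T v] = [T^2 u, v] + [u, T^2 v].  So T can be moved through brackets,
    and both ways of composing the new product simplify:
    - (u o v) o w = T [v, [T u, w]] - [v, [T^2 u, w]] (circA_l),
    - u o (v o w) = [T u, [T v, w]] - T [u, [T v, w]] - [T^2 u, [v, w]]
      (circA_r).

    In the associator, exchanging u and v exchanges the two terms headed by T;
    what is left is [[T^2 u, v], w] - [T u, [T v, w]], whose
    antisymmetrization in u, v is [[T^2 u, v] + [u, T^2 v] - [T u, T v], w] = 0.
    Right commutativity follows from the first formula: antisymmetrizing it in
    v, w gives T [T u, [v, w]] - [T^2 u, [v, w]] = 0.  The compatibility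
    condition is the image under T of the Jacobi identity for w, u, v, minus
    the Jacobi identity for T w, u, v. *)

Lemma subrACA (V : zmodType) (x y z t : V) :
  (x - y) - (z - t) = (x - z) - (y - t).
Proof. by rewrite !opprD addrACA. Qed.

Section LieAlgebra.
Variables (F : fieldType) (G : lmodType F) (br : G -> G -> G).
Hypothesis hLie : is_lie_algebra br.

Lemma brPr a u x y : br u (a *: x + y) = a *: br u x + br u y.
Proof. by case: hLie => -[_ H] _ _; apply: H. Qed.

Lemma brPl a u x y : br (a *: x + y) u = a *: br x u + br y u.
Proof. by case: hLie => -[H _] _ _; apply: H. Qed.

Lemma brDr u x y : br u (x + y) = br u x + br u y.
Proof. by have := brPr 1 u x y; rewrite !scale1r. Qed.

Lemma brDl u x y : br (x + y) u = br x u + br y u.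
Proof. by have := brPl 1 u x y; rewrite !scale1r. Qed.

Lemma brBr u x y : br u (x - y) = br u x - br u y.
Proof. by rewrite -scaleN1r addrC brPr scaleN1r addrC. Qed.

Lemma brBl u x y : br (x - y) u = br x u - br y u.
Proof. by rewrite -scaleN1r addrC brPl scaleN1r addrC. Qed.

Lemma brC u v : br u v = - br v u.
Proof.
case: hLie => _ alt _; apply/eqP; rewrite -addr_eq0.
by have := alt (u + v); rewrite brDl !brDr !alt add0r addr0 => ->.
Qed.

Lemma brNr u x : br u (- x) = - br u x.
Proof.
have br0 : br u 0 = 0 by have := brBr u 0 0; rewrite !subrr.
by rewrite -[- x]sub0r brBr br0 sub0r.
Qed.

(** The Jacobi identity in the form: the adjoint map [u |-> br u] sends brackets
    to commutators. *)
Lemma br_ad u v w : br (br u v) w = br u (br v w) - br v (br u w).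
Proof.
case: hLie => _ _ jac; have := jac u v w.
rewrite [br w (br u v)]brC [br w u]brC brNr => /eqP.
by rewrite subr_eq0 => /eqP.
Qed.

Variable T : {linear G -> G}.
Hypothesis hR : is_classical_Rmatrix br T.
Hypothesis hT : forall u v, T (br u (T v)) = br u (T (T v)).

(** The mirror image of the hypothesis [hT], through antisymmetry. *)
Lemma T_brT u v : T (br (T u) v) = br (T (T u)) v.
Proof. by rewrite brC linearN hT -brC. Qed.

Lemma br_TT u v : br (T u) (T v) = br (T (T u)) v + br u (T (T v)).
Proof. by rewrite hR T_brT hT. Qed.

Definition circ u v := T (br u v) - br (T u) v.

Lemma circ_bilinear : bilinear_op circ.
Proof.
split=> u a x y; rewrite /circ /=.
  by rewrite linearP !brPl linearP scalerBr opprD addrACA.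
by rewrite !brPr linearP scalerBr opprD addrACA.
Qed.

Lemma circT u v : circ u (T v) = - br (T (T u)) v.
Proof. by rewrite /circ hT br_TT [X in _ - X]addrC opprD addrA subrr sub0r. Qed.

Lemma circA_l u v w :
  circ (circ u v) w = T (br v (br (T u) w)) - br v (br (T (T u)) w).
Proof.
rewrite {2}/circ /circ linearB !brBl linearB !T_brT.
rewrite subrACA subrr sub0r opprB !br_ad linearB T_brT.
by rewrite subrACA subrr sub0r opprB.
Qed.

Lemma circA_r u v w :
  circ u (circ v w)
  = br (T u) (br (T v) w) - T (br u (br (T v) w)) - br (T (T u)) (br v w).
Proof.
have circBr x y : circ u (x - y) = circ u x - circ u y.
  by rewrite /circ !brBr linearB subrACA.
by rewrite {2}/circ circBr circT addrC {1}/circ opprB.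
Qed.

(** The first summand is symmetric in [u] and [v], so only the second one
    matters for left symmetry. *)
Lemma circ_associator u v w :
  circ (circ u v) w - circ u (circ v w)
  = (T (br u (br (T v) w)) + T (br v (br (T u) w)))
    + (br (br (T (T u)) v) w - br (T u) (br (T v) w)).
Proof.
rewrite circA_l circA_r br_ad !opprB.
by rewrite [LHS](AC (2*(1*2)) ((4*1)*((3*2)*5))).
Qed.

Lemma circ_left_symmetric u v w :
  circ (circ u v) w - circ u (circ v w)
  = circ (circ v u) w - circ v (circ u w).
Proof.
rewrite !circ_associator [X in X + _ = _]addrC; congr (_ + _).
apply/eqP; rewrite -subr_eq0 subrACA subr_eq0 -br_ad br_TT.
by rewrite [br u (T _)]brC brBl.
Qed.

Lemma circ_right_comm u v w : circ (circ u v) w = circ (circ u w) v.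
Proof.
rewrite !circA_l; apply/eqP; rewrite -subr_eq0 subrACA -linearB.
have swap x : br v (br x w) - br w (br x v) = br x (br v w).
  by rewrite [br w _]brC opprK br_ad addrC subrK.
by rewrite !swap T_brT subrr.
Qed.

Lemma circ_compatible u v w :
  circ (br w u) v - circ (br w v) u + br (circ w u) v
  - br (circ w v) u - circ w (br u v) = 0.
Proof.
have jac x : br x (br u v) = br (br x u) v - br (br x v) u.
  by rewrite br_ad [br (br x v) u]brC opprK subrK.
rewrite /circ !brBl !jac [T (_ - _)]linearB.
rewrite -[X in X - (_ - _ - _)]addrA.
(* Regroup so that the terms [br (T (br w _)) _] cancel; what remains is the
   expansion of the last term by [jac w] and [jac (T w)]. *)
rewrite [X in X + _ - _ = _]subrACA [X in _ + X - _ = _]subrACA.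
by rewrite addrA subrK subrr.
Qed.

End LieAlgebra.

Theorem mainTheorem1 (F : fieldType) (G : lmodType F) (br : G -> G -> G)
    (hLie : is_lie_algebra br)
    (T : {linear G -> G})
    (hR : is_classical_Rmatrix br T)
    (hT : forall u v : G, T (br u (T v)) = br u (T (T v))) :
  is_novikov_algebra_over br (fun u v : G => T (br u v) - br (T u) v).
Proof.
change (is_novikov_algebra_over br (circ br T)).
split; first exact: hLie.
  split; first exact: circ_bilinear.
    exact: circ_left_symmetric.
  exact: circ_right_comm.
exact: circ_compatible.
Qed.
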